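(* Let $V$ be a finite set with $|V|=n$. Then every set $\mathcal{E}$ of three-point subsets of $V$ with $|\mathcal{E}|=\binom{n}{3}-n+5$ is an anchor in $V$.
   Context: Given a metric space $(V,\mathrm{dist})$, write $[rst]$ to signify that $r,s,t$ are pairwise distinct points of $V$ and $\mathrm{dist}(r,s)+\mathrm{dist}(s,t)=\mathrm{dist}(r,t)$. Three-point subsets of $V$ are called triangles; a triangle is called degenerate if its three points can be named $r,s,t$ so that $[rst]$. A set $\mathcal{E}$ of three-point subsets of a set $V$ is called an anchor in $V$ if, for every metric $\mathrm{dist}$ on $V$ such that all triangles in $\mathcal{E}$ are degenerate in $(V,\mathrm{dist})$, there is a linear (total) order $\preceq$ on $V$ such that, for all $r,s,t\in V$, $r\prec s\prec t$ implies $[rst]$. The expression $\binom{n}{3}-n+5$ is evaluated in the integers. *)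

(* Defs.v *)
From HB Require Import structures.
From mathcomp Require Import all_boot all_order all_algebra.
From mathcomp Require Import wochoice reals.

Set Implicit Arguments.
Unset Strict Implicit.
Unset Printing Implicit Defensive.

Import Order.TTheory GRing.Theory Num.Theory.
Local Open Scope ring_scope.

(* MathComp-Analysis' [metricType] attaches one fixed metric to a type, whereas
   here the metric varies over a fixed point set. *)
Definition is_metric (R : realType) (V : Type) (dist : V -> V -> R) : Prop :=
  [/\ forall x y, 0 <= dist x y,
      forall x y, dist x y = 0 <-> x = y,
      forall x y, dist x y = dist y x
    & forall x y z, dist x z <= dist x y + dist y z].

(* The relation written [rst]. *)
Definition between (R : realType) (V : eqType) (dist : V -> V -> R)
    (r s t : V) : Prop :=
  [/\ r <> s, s <> t, r <> t & dist r s + dist s t = dist r t].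

Definition three_point_sets (V : finType) (E : {set {set V}}) : Prop :=
  forall e, e \in E -> #|e| = 3%N.

Definition degenerate (R : realType) (V : finType) (dist : V -> V -> R)
    (e : {set V}) : Prop :=
  exists r s t, e = [set r; s; t] /\ between dist r s t.

(* [total_order le]: [le] is reflexive, transitive, antisymmetric and total;
   its strict part is [le r s && (r != s)]. *)
Definition anchor (R : realType) (V : finType) (E : {set {set V}}) : Prop :=
  three_point_sets E /\
  forall dist : V -> V -> R, is_metric dist ->
    (forall e, e \in E -> degenerate dist e) ->
    exists le : rel V, total_order le /\
      forall r s t : V,
        le r s && (r != s) -> le s t && (s != t) -> between dist r s t.

(* Main.v *)
(* Call a triangle bad if it is not degenerate; there are [n - 5] triangles
   outside [E], hence at most that many bad ones.  If deleting each of three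
   points [a], [b], [c] of [S] leaves an isometric copy of a subset of the line
   and [S] has two further points, then so does [S] itself: an embedding is
   determined by its values at two points, so the three partial embeddings
   agree where they overlap.  By induction on [k], a set of [k + 5] points with
   at most [k] bad triangles lies on a line: delete in turn the vertices of a
   bad triangle (or any three points if there is none).  The base case, five
   points without a bad triangle, is due to Menger: a nonlinear quadruple with
   only degenerate triangles has equal opposite sides, and two such quadruples
   cannot share three points. *)
Require Import Defs.
From HB Require Import structures.
From mathcomp Require Import all_boot all_order all_algebra.
From mathcomp Require Import boolp wochoice reals.
From mathcomp Require Import zify lra.

Set Implicit Arguments.
Unset Strict Implicit.
Unset Printing Implicit Defensive.

Import Order.TTheory GRing.Theory Num.Theory.
Local Open Scope ring_scope.

Section LineEmbedding.
Variables (R : realType) (V : finType) (dist : V -> V -> R).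
Hypothesis metric_dist : is_metric dist.

(** * Isometric embeddings of subsets into the line *)

Definition line_embeds (f : V -> R) (S : {set V}) : Prop :=
  {in S &, forall u v, dist u v = `|f u - f v|}.

(** Betweenness as bare equations between distances, ready for linear arithmetic; unlike in
    [degenerate], the points need not be distinct. *)
Definition flat (x y z : V) : Prop :=
  [\/ dist x y + dist y z = dist x z,
      dist x z + dist y z = dist x y
    | dist x y + dist x z = dist y z].

(** With flat triangles these are Menger's pseudo-linear quadruples: each triangle has the same
    three side lengths, one being the sum of the others. *)
Definition opposite_sides_equal (w x y z : V) : Prop :=
  [/\ dist w x = dist y z, dist w y = dist x z & dist w z = dist x y].

Lemma distC x y : dist x y = dist y x.
Proof. by have [_ _ ->] := metric_dist. Qed.

Lemma dist_gt0 x y : x != y -> 0 < dist x y.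
Proof.
have [ge0 eq0 _ _] := metric_dist.
move=> xy; rewrite lt_neqAle ge0 andbT eq_sym.
by apply: contra_neq xy => /eq0.
Qed.

Lemma distxx x : dist x x = 0.
Proof. by have [_ eq0 _ _] := metric_dist; apply/eq0. Qed.

Lemma line_embedsS f (S T : {set V}) :
  S \subset T -> line_embeds f T -> line_embeds f S.
Proof. by move=> /subsetP ST fT u v /ST uT /ST; apply: fT. Qed.

(** If [x] and [y] differed, both [p] and [q] would be their midpoint. *)
Lemma dist_to_two_points (p q x y : R) :
  p != q -> `|x - p| = `|y - p| -> `|x - q| = `|y - q| -> x = y.
Proof.
move=> /eqP npq /eqP; rewrite eqr_norm2 => /orP[/eqP|/eqP e1]; first by lra.
move=> /eqP; rewrite eqr_norm2 => /orP[/eqP|/eqP e2]; first by lra.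
by case: npq; lra.
Qed.

Lemma line_embeds_inj f S : line_embeds f S -> {in S &, injective f}.
Proof.
move=> fS u v uS vS efuv; apply/eqP; apply/negPn/negP => /dist_gt0.
by rewrite fS // efuv subrr normr0 ltxx.
Qed.

Lemma line_embeds_unique f g S p q :
  line_embeds f S -> line_embeds g S -> p \in S -> q \in S -> p != q ->
  f p = g p -> f q = g q -> {in S, f =1 g}.
Proof.
move=> fS gS pS qS npq fp fq u uS.
apply: (@dist_to_two_points (f p) (f q)).
- by apply: contra_neq npq => /(line_embeds_inj fS pS qS).
- by rewrite {2}fp -fS // -gS.
- by rewrite {2}fq -fS // -gS.
Qed.

(** A translation, or a reflection followed by one, moves [f p] and [f q] to the prescribed
    places. *)
Lemma line_embeds_align f g S p q :
  line_embeds f S -> p \in S -> q \in S -> dist p q = `|g p - g q| ->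
  exists h, [/\ line_embeds h S, h p = g p & h q = g q].
Proof.
move=> fS pS qS; rewrite fS // => /eqP; rewrite eqr_norm2 => /orP[] /eqP fg.
- exists (fun u => f u - f p + g p); split; [|lra..].
  by move=> u v uS vS; rewrite fS //; congr `|_|; lra.
- exists (fun u => f p - f u + g p); split; [|lra..].
  by move=> u v uS vS; rewrite fS // distrC; congr `|_|; lra.
Qed.

Lemma line_embeds_glue (S : {set V}) a b c p q :
  a \in S -> b \in S -> a != b -> b != c -> c != a ->
  p \in S :\: [set a; b; c] -> q \in S :\: [set a; b; c] -> p != q ->
  (exists f, line_embeds f (S :\ a)) ->
  (exists f, line_embeds f (S :\ b)) ->
  (exists f, line_embeds f (S :\ c)) ->
  exists f, line_embeds f S.
Proof.
move=> aS bS nab nbc nca.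
rewrite !inE !negb_or -!andbA => /and4P[pa pb pc pS] /and4P[qa qb qc qS] npq.
move=> [g gE] [h0 h0E] [k0 k0E].
have gpq : dist p q = `|g p - g q| by apply: gE; rewrite !inE ?pa ?qa.
have [||h [hE hp hq]] := line_embeds_align h0E _ _ gpq; rewrite ?inE ?pb ?qb //.
have [||k [kE kp kq]] := line_embeds_align k0E _ _ gpq; rewrite ?inE ?pc ?qc //.
have agree (f1 f2 : V -> R) x y u : line_embeds f1 (S :\ x) -> line_embeds f2 (S :\ y) ->
    p != x -> p != y -> q != x -> q != y -> f1 p = f2 p -> f1 q = f2 q ->
    u \in S -> u != x -> u != y -> f1 u = f2 u.
  move=> f1E f2E px py qx qy e1 e2 uS ux uy.
  apply: (@line_embeds_unique _ _ (S :\ x :\ y) p q);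
    rewrite ?inE ?px ?py ?qx ?qy ?ux ?uy //.
    by apply: line_embedsS f1E; apply: subsetDl.
  by apply: line_embedsS f2E; apply: setSD; apply: subsetDl.
(* [F] follows [h] at [a] and [g] elsewhere. Only the distance from [a] to [b] is seen by neither
   map; [k], defined at both points, supplies it. *)
have ka : k a = h a.
  by apply: (agree _ _ c b) => //; rewrite ?kp ?kq // eq_sym.
have kb : k b = g b.
  by apply: (agree _ _ c a) => //; rewrite eq_sym.
pose F u := if u == a then h a else g u.
have Fa v : v \in S -> v != a -> dist a v = `|h a - g v|.
  move=> vS va; have [->|vb] := eqVneq v b.
    by rewrite -ka -kb; apply: kE; rewrite !inE ?aS ?bS andbT // eq_sym.
  rewrite hE ?inE ?vb ?nab //; congr `|_ - _|.
  by apply: (agree _ _ b a).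
exists F => u v uS vS; rewrite /F.
have [->|ua] := eqVneq u a; have [->|va] := eqVneq v a.
- by rewrite distxx subrr normr0.
- exact: Fa.
- by rewrite distC Fa // distrC.
- by apply: gE; rewrite !inE ?ua ?va.
Qed.

(** [T] holds points whose deletion is known to be linear: all of [S], all but one point, or a bad
    triangle. *)
Lemma line_embeds_delete_three (S T : {set V}) :
  (4 < #|S|)%N -> T \subset S -> (2 < #|T|)%N ->
  (forall v, v \in T -> exists f, line_embeds f (S :\ v)) ->
  exists f, line_embeds f S.
Proof.
move=> S5 /subsetP TS /card_gt2P[a [b [c [[aT bT cT] [ab bc ca]]]]] linT.
have : (1 < #|S :\: [set a; b; c]|)%N.
  rewrite cardsD; have := subset_leq_card (subsetIr S [set a; b; c]).
  by rewrite setUC cardsU1 cards2; case: (_ \notin _); case: (_ != _); lia.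
case/card_gt1P=> p [q [pS qS pq]].
by apply: (line_embeds_glue (TS _ aT) (TS _ bT) ab bc ca pS qS pq); apply: linT.
Qed.

(** * Four points with flat triangles *)

Lemma flat_coordinate a b c :
  a != b -> a != c -> b != c -> flat a b c ->
  exists z, dist a c = `|z| /\ dist b c = `|z - dist a b|.
Proof.
move=> /dist_gt0 ab /dist_gt0 ac /dist_gt0 bc [] e.
(* With [a] at 0 and [b] at [dist a b], the cases put [c] beyond [b], between the two, and on the
   far side of [a]. *)
- by exists (dist a c); rewrite !ger0_norm; lra.
- by exists (dist a c); split; [rewrite ger0_norm | rewrite ler0_norm]; lra.
- by exists (- dist a c); split; rewrite ler0_norm; lra.
Qed.

(** Flatness makes [dist y z] the sum or the difference of [|s|] and [|t|]; these are [|s - t|] and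
    [|s + t|], in an order that depends on the signs. *)
Lemma norm_sum_or_diff x y z (s t : R) :
  dist x y = `|s| -> dist x z = `|t| -> flat x y z ->
  dist y z = `|s - t| \/ dist y z = `|s + t|.
Proof.
rewrite /flat => -> ->.
have yz : 0 <= dist y z by have [-> _ _ _] := metric_dist.
case: (ger0P s) (ger0P t) => [s0|s0] [t0|t0];
  case: (ger0P (s - t)) (ger0P (s + t)) => [d0|d0] [a0|a0] [] e;
  by [left; lra | right; lra].
Qed.

(* Put [w], [x] at [0], [D] and [y], [z] at [s], [t].  If [dist y z] is not
   [`|s - t|], it is both [`|s + t|] and [`|s + t - 2 * D|], so [s + t = D]. *)
Lemma four_points w x y z :
  uniq [:: w; x; y; z] ->
  flat w x y -> flat w x z -> flat w y z -> flat x y z ->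
  (exists f, line_embeds f [set w; x; y; z]) \/ opposite_sides_equal w x y z.
Proof.
rewrite /= !inE !negb_or !andbT -!andbA => /andP[wx /and5P[wy wz xy xz yz]].
move=> /(flat_coordinate wx wy xy)[s [ws xs]] /(flat_coordinate wx wz xz)[t [wt xt]].
rewrite /flat => f1 f2.
have D0 := dist_gt0 wx; have yz0 := dist_gt0 yz.
have [e|ne] := eqVneq (dist y z) `|s - t|.
  left; exists (fun u => if u == w then 0 else if u == x then dist w x else
                 if u == y then s else t).
  move=> u v; rewrite !inE -!orbA.
  have [xw yw zw] : [/\ x == w = false, y == w = false & z == w = false].
    by split; rewrite eq_sym; apply: negbTE.
  have [yx zx zy] : [/\ y == x = false, z == x = false & z == y = false].
    by split; rewrite eq_sym; apply: negbTE.
  move=> /or4P[] /eqP -> /or4P[] /eqP ->;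
    rewrite ?(eqxx, xw, yw, zw, yx, zx, zy) ?distxx ?subrr ?sub0r ?subr0
      ?normrN ?normr0 ?(gtr0_norm D0) //;
    first [by rewrite distC | by rewrite distrC | by rewrite distC distrC].
right.
have yzE1 := norm_sum_or_diff ws wt f1.
have yzE2 := norm_sum_or_diff xs xt f2.
have e1 : dist y z = `|s + t|.
  by case: yzE1 => // e; rewrite e eqxx in ne.
have e2 : dist y z = `|s + t - 2 * dist w x|.
  case: yzE2 => e; first by case/eqP: ne; rewrite e; congr `|_|; lra.
  by rewrite e; congr `|_|; lra.
have st : s + t = dist w x.
  by move/eqP: e2; rewrite e1 eqr_norm2 => /orP[] /eqP; lra.
split; first by rewrite e1 st ger0_norm ?ltW.
  by rewrite ws xt -st -normrN; congr `|_|; lra.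
by rewrite wt xs -st -normrN; congr `|_|; lra.
Qed.

(** Each of [x], [y], [z] is equidistant from [u] and [v], so flatness makes it a midpoint. Then
    [x], [y], [z] form an equilateral triangle of positive side, which is not flat. *)
Lemma opposite_sides_equal_unique u v x y z :
  uniq [:: u; v; x; y; z] -> flat u v x -> flat u v y -> flat u v z ->
  flat x y z ->
  opposite_sides_equal u x y z -> opposite_sides_equal v x y z -> False.
Proof.
rewrite /= !inE !negb_or !andbT -!andbA.
case/andP=> /dist_gt0 uv _ fx fy fz fxyz [ux uy uz] [vx vy vz].
have {fx} ex : dist u v = 2 * dist u x.
  by move: fx uv; rewrite /flat vx -ux => -[]; lra.
have {fy} ey : dist u v = 2 * dist u y.
  by move: fy uv; rewrite /flat vy -uy => -[]; lra.
have {fz} ez : dist u v = 2 * dist u z.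
  by move: fz uv; rewrite /flat vz -uz => -[]; lra.
by move: fxyz; rewrite /flat -uz -ux -uy => -[]; lra.
Qed.

(** * Five points without bad triangles *)

Lemma degenerate_flat x y z :
  x != y -> x != z -> y != z -> degenerate dist [set x; y; z] -> flat x y z.
Proof.
move=> /negP xy /negP xz /negP yz [r [s [t [E [rs st rt e]]]]].
have : [/\ r \in [set x; y; z], s \in [set x; y; z] & t \in [set x; y; z]].
  by rewrite E !inE !eqxx !orbT.
rewrite !inE -!orbA => -[/or3P[] /eqP ? /or3P[] /eqP ? /or3P[] /eqP ?];
  subst r s t => //; move: e; rewrite ?(distC y x) ?(distC z x) ?(distC z y);
  by [constructor 1; lra | constructor 2; lra | constructor 3; lra].
Qed.

Definition all_flat (S : {set V}) : Prop :=
  {in S & &, forall x y z, x != y -> x != z -> y != z -> flat x y z}.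

Lemma four_points_set (S : {set V}) w x y z :
  S = [set w; x; y; z] -> uniq [:: w; x; y; z] -> all_flat S ->
  (exists f, line_embeds f S) \/ opposite_sides_equal w x y z.
Proof.
move=> -> U flatS; move: (U); rewrite /= !inE !negb_or !andbT -!andbA.
case/andP=> wx /and5P[wy wz xy xz yz].
by apply: four_points => //; apply: flatS; rewrite ?inE ?eqxx ?orbT.
Qed.

Lemma five_points_flat (S : {set V}) :
  #|S| = 5%N -> all_flat S -> exists f, line_embeds f S.
Proof.
move=> S5 flatS.
(* If both deletions failed, two pseudo-linear quadruples would share the remaining points [x], [y],
   [z]. *)
have two_deletions u v : u \in S -> v \in S -> u != v ->
  (exists f, line_embeds f (S :\ u)) \/ (exists f, line_embeds f (S :\ v)).
  move=> uS vS nuv.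
  have : (2 < #|S :\ u :\ v|)%N.
    move: S5; rewrite (cardsD1 u) uS (cardsD1 v (S :\ u)) !inE vS eq_sym nuv /=.
    by lia.
  case/card_gt2P=> x [y [z [[]]]].
  rewrite !inE => /and3P[xv xu xS] /and3P[yv yu yS] /and3P[zv zu zS] [xy yz zx].
  have [vx vy] : v != x /\ v != y by rewrite !(eq_sym v).
  have [ux uy] : u != x /\ u != y by rewrite !(eq_sym u).
  have [vz uz] : v != z /\ u != z by rewrite !(eq_sym _ z).
  have xz : x != z by rewrite eq_sym.
  have quad p q : p \in S -> q \in S -> q != p -> x != p -> y != p -> z != p ->
      uniq [:: q; x; y; z] -> S :\ p = [set q; x; y; z].
    move=> pS qS qp xp yp zp U; apply/esym/eqP; rewrite eqEcard; apply/andP; split.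
      by apply/subsetP => w; rewrite !inE -!orbA => /or4P[] /eqP ->;
        rewrite ?qp ?xp ?yp ?zp.
    have -> : #|S :\ p| = 4%N by move: S5; rewrite (cardsD1 p) pS => -[].
    rewrite -(card_uniqP U : #|_| = 4%N).
    by apply/subset_leq_card/subsetP => w; rewrite !inE -!orbA.
  have flatD p : all_flat (S :\ p).
    by move=> i j l /setD1P[_ iS] /setD1P[_ jS] /setD1P[_ lS]; apply: flatS.
  have nvu : v != u by rewrite eq_sym.
  have Uv : uniq [:: v; x; y; z] by rewrite /= !inE !negb_or vx vy vz xy xz yz.
  have Uu : uniq [:: u; x; y; z] by rewrite /= !inE !negb_or ux uy uz xy xz yz.
  case: (four_points_set (quad u v uS vS nvu xu yu zu Uv) Uv (flatD u)).
    by left.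
  case: (four_points_set (quad v u vS uS nuv xv yv zv Uu) Uu (flatD v)).
    by right.
  move=> Ou Ov; case: (@opposite_sides_equal_unique u v x y z) => //; try exact: flatS.
  by rewrite /= !inE !negb_or nuv ux uy uz vx vy vz xy xz yz.
(* So at most one deletion fails; [v0] is that point, or an arbitrary one if all succeed. *)
have [v0 v0S lin] : exists2 v0, v0 \in S &
    forall u, u \in S -> u != v0 -> exists f, line_embeds f (S :\ u).
  have [[v [vS nlin]]|allin] :=
      EM (exists v, v \in S /\ ~ exists f, line_embeds f (S :\ v)).
    by exists v => // u uS uv; case: (two_deletions u v uS vS uv) => // /nlin.
  have [v vS] : exists v, v \in S by apply/card_gt0P; rewrite S5.
  by exists v => // u uS _; apply: contrapT => nlin; apply: allin; exists u.
apply: (@line_embeds_delete_three S (S :\ v0)); rewrite ?S5 ?subsetDl //.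
  by rewrite (cardsD1 v0) v0S in S5; lia.
by move=> u /setD1P[uv0 uS]; apply: lin.
Qed.

(** * Induction on the number of bad triangles *)

Lemma few_bad_triangles (B : {set {set V}}) k (S : {set V}) :
  (forall e : {set V}, e \in B -> #|e| = 3%N) ->
  (forall e : {set V}, #|e| = 3%N -> e \notin B -> degenerate dist e) ->
  #|S| = (k + 5)%N -> (#|[set e in B | e \subset S]| <= k)%N ->
  exists f, line_embeds f S.
Proof.
move=> B3 Bdeg; elim: k S => [|k IHk] S Sk.
  rewrite leqn0 cards_eq0 => /eqP B0; apply: five_points_flat => //.
  move=> x y z xS yS zS xy xz yz; apply: degenerate_flat => //; apply: Bdeg.
    by rewrite setUC cardsU1 cards2 !inE !(eq_sym z) (negbTE xz) (negbTE yz) xy.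
  apply/negP => eB; have /setP/(_ [set x; y; z]) := B0.
  rewrite !inE eB /= => /negP[]; apply/subsetP => w.
  by rewrite !inE -orbA => /or3P[] /eqP ->.
set bad := [set e in B | e \subset S] => badk.
have delete v : v \in S -> (#|[set e in B | e \subset S :\ v]| <= k)%N ->
    exists f, line_embeds f (S :\ v).
  by move=> vS; apply: IHk; rewrite (cardsD1 v) vS in Sk; lia.
have sub_bad v : [set e in B | e \subset S :\ v] \subset bad.
  apply/subsetP => e; rewrite !inE => /andP[-> /=] /subset_trans.
  by apply; apply: subsetDl.
have S5 : (4 < #|S|)%N by rewrite Sk; lia.
have [bad0|[e]] := set_0Vmem bad.
  apply: (line_embeds_delete_three S5 (subxx S)); first by lia.
  move=> v vS; apply: delete => //.
  by apply: leq_trans (subset_leq_card (sub_bad v)) _; rewrite bad0 cards0.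
rewrite inE => /andP[eB eS].
apply: (line_embeds_delete_three S5 eS); first by rewrite B3.
move=> v ve; apply: delete; first exact: (subsetP eS).
(* Deleting a vertex of [e] destroys [e] itself, so the count drops strictly. *)
rewrite -ltnS; apply: leq_trans badk; apply: proper_card.
apply/properP; split=> //; exists e; rewrite inE eB //=.
by apply/negP => /subsetP/(_ v ve); rewrite !inE eqxx.
Qed.

(** * From an embedding to a linear order *)

Lemma between_of_line_embedding f r s t :
  line_embeds f setT -> f r < f s -> f s < f t -> between dist r s t.
Proof.
move=> fE rs st; have rt := lt_trans rs st.
have neq u v : f u < f v -> u <> v by move=> uv e; rewrite e ltxx in uv.
split; [exact: neq.. |].
by rewrite !fE ?inE // ltr0_norm ?subr_lt0 // ltr0_norm ?subr_lt0 //
  ltr0_norm ?subr_lt0 //; lra.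
Qed.

End LineEmbedding.

Theorem theorem2 (R : realType) (V : finType) (n : nat) (hV : #|V| = n)
    (E : {set {set V}}) (hE : three_point_sets E)
    (hcard : (#|E|%:Z = 'C(n, 3)%:Z - n%:Z + 5%:Z)%R) :
  anchor R E.
Proof.
split=> // dist dM degE.
(* [B] may contain degenerate triangles too; what matters is that it contains every bad one. *)
pose D := [set e : {set V} | #|e| == 3]; pose B := D :\: E.
have cardB : (#|E| + #|B| = 'C(n, 3))%N.
  rewrite -hV -card_draws -/D -(cardsID E D) (setIidPr _) //.
  by apply/subsetP => e /hE; rewrite inE => ->.
(* Over the integers [hcard] and [cardB] give [#|B| = n - 5]; hence [n] is at least 5 and the
   truncated subtraction is exact. *)
have [k nk Bk] : exists2 k, n = (k + 5)%N & #|B| = k.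
  by exists (n - 5)%N; lia.
have [||||f fE] := @few_bad_triangles R V dist dM B k setT.
- by move=> e; rewrite !inE => /andP[_ /eqP].
- by move=> e e3; rewrite !inE e3 eqxx andbT negbK; apply: degE.
- by rewrite cardsT hV.
- by rewrite -Bk subset_leq_card //; apply/subsetP => e; rewrite inE => /andP[].
have f_inj u v : f u = f v -> u = v.
  by apply: (line_embeds_inj dM fE); rewrite inE.
(* The order of the line is pulled back along [f]; injectivity gives antisymmetry. *)
exists (fun u v => f u <= f v); split.
  split; last by move=> u v; apply: le_total.
  split; first by split=> [u|v u w]; [apply: lexx | apply: le_trans].
  by move=> u v /le_anti; apply: f_inj.
move=> r s t /andP[rs nrs] /andP[st nst].
apply: (between_of_line_embedding fE); rewrite lt_neqAle ?rs ?st andbT.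
  by apply: contra_neq nrs; apply: f_inj.
by apply: contra_neq nst; apply: f_inj.
Qed.
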